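(* Let $r$ be a positive integer and $s=(r,r,\ldots,r)$ of length $n$. Then \[ d_n^s(z)=\sum_{\omega\in\mathcal{SW}(n+1,r)}z^{\mathrm{des}(\omega)}. \] Moreover, the local $h$-polynomial of the $r$-th edgewise subdivision of the $n$-simplex $2^{[n+1]}$ equals the local $h^\ast$-polynomial of the $s$-lecture hall simplex $P_n^s$.
   Context: $P_n^s=\{x\in\mathbb{R}^n:0\le x_1/s_1\le\cdots\le x_n/s_n\le1\}$; $d_n^s(z):=\ell^\ast(P_n^s;z)$ where for a lattice $d$-simplex $\Delta=\mathrm{conv}(v^{(0)},\ldots,v^{(d)})\subset\mathbb{R}^n$, $\ell^\ast(\Delta;z)=\sum_{x\in\Pi^\circ_\Delta\cap\mathbb{Z}^{n+1}}z^{x_{n+1}}$, $\Pi^\circ_\Delta=\{\sum_i\lambda_i(v^{(i)},1):0<\lambda_i<1\}$. $\mathcal{SW}(m,r)$ (Smirnoff words) is the set of strings $\omega_0\omega_1\cdots\omega_m$ with $\omega_i\in\{0,\ldots,r-1\}$, $\omega_0=\omega_m=0$, and $\omega_i\ne\omega_{i+1}$ for $0\le i<m$; $\mathrm{des}(\omega)=|\{i:\omega_i>\omega_{i+1}\}|$. The $r$-th edgewise subdivision of $2^{[n+1]}$: its vertices are the points $x\in\mathbb{Z}_{\ge0}^{n+1}$ with $x_1+\cdots+x_{n+1}=r$; with $\varphi(x)=(x_1,x_1+x_2,\ldots,x_1+\cdots+x_{n+1})$, a set $F$ of vertices is a face iff for all $x,y\in F$, $\varphi(x)-\varphi(y)\in\{0,1\}^{n+1}$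 or $\varphi(y)-\varphi(x)\in\{0,1\}^{n+1}$; a face $F$ lies over the face $\bigcup_{x\in F}\mathrm{supp}(x)$ of $2^{[n+1]}$. For a $(d-1)$-dimensional complex $\Omega$, $h(\Omega;z)=\sum_{i=0}^d f_{i-1}z^i(1-z)^{d-i}$; for a subdivision $\Omega$ of $2^V$, $|V|=m$, with restrictions $\Omega_F$ to faces $F\subseteq V$ ($h(\Omega_\emptyset;z)=1$), the local $h$-polynomial is $\ell_V(\Omega_V;z)=\sum_{F\subseteq V}(-1)^{m-|F|}h(\Omega_F;z)$. *)

(* Defs.v *)
From HB Require Import structures.
From mathcomp Require Import all_boot all_order all_algebra.
From mathcomp Require Import boolp.
Set Implicit Arguments. Unset Strict Implicit. Unset Printing Implicit Defensive.
Import Order.TTheory GRing.Theory Num.Theory.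
Local Open Scope ring_scope.

(* the lifted vertex (v^(i), 1) in Z^(n+1); coordinate n is the appended 1 *)
Definition lift_vert (n d : nat) (v : 'I_d.+1 -> 'I_n -> int)
  (i : 'I_d.+1) (j : 'I_n.+1) : int :=
  if (insub (j : nat) : option 'I_n) is Some j' then v i j' else 1.

Definition in_open_pp (n d : nat) (v : 'I_d.+1 -> 'I_n -> int)
  (x : 'I_n.+1 -> int) : Prop :=
  exists lam : 'I_d.+1 -> rat,
    (forall i, 0 < lam i < 1) /\
    (forall j, (x j)%:~R = \sum_(i < d.+1) lam i * (lift_vert v i j)%:~R).

(* A box of integer points certainly containing Pi^o_Delta /\ Z^(n+1):
   every coordinate of a point of Pi^o_Delta has absolute value < B. *)
Definition pp_bound (n d : nat) (v : 'I_d.+1 -> 'I_n -> int) : nat :=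
  (d.+1 + \sum_(i < d.+1) \sum_(j < n) `|v i j|)%N.

Definition box_pt (n B : nat) (y : {ffun 'I_n.+1 -> 'I_(B.*2.+1)})
  : 'I_n.+1 -> int := fun j => (y j)%:Z - B%:Z.

Definition lstar (n d : nat) (v : 'I_d.+1 -> 'I_n -> int) : {poly int} :=
  let B := pp_bound v in
  \sum_(y : {ffun 'I_n.+1 -> 'I_(B.*2.+1)})
     (if `[< in_open_pp v (box_pt y) >]
      then 'X^(absz (box_pt y ord_max)) else 0).

(* The s-lecture hall simplex
   P_n^s = {x : 0 <= x_1/s_1 <= ... <= x_n/s_n <= 1}
   has vertices v^(i) = (0,...,0,s_(n-i+1),...,s_n), i = 0..n. *)
Definition lhs_vert (n : nat) (s : 'I_n -> nat) (i : 'I_n.+1) (j : 'I_n) : int :=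
  if (n - i <= j)%N then (s j)%:Z else 0.

Definition dns (n : nat) (s : 'I_n -> nat) : {poly int} := lstar (lhs_vert s).

Definition smirnov (m r : nat) (w : {ffun 'I_m.+1 -> 'I_r}) : bool :=
  [&& (w ord0 == 0%N :> nat), (w ord_max == 0%N :> nat) &
      [forall i : 'I_m, (w (inord i) : nat) != w (inord i.+1)]].

Definition des (m r : nat) (w : {ffun 'I_m.+1 -> 'I_r}) : nat :=
  #|[set i : 'I_m | (w (inord i.+1) < w (inord i))%N]|.

(* r-th edgewise subdivision of the simplex 2^[n+1].
   Vertices: x in Z_{>=0}^(n+1) with x_1 + ... + x_(n+1) = r (so x_i <= r). *)
Definition evert (n r : nat) := {ffun 'I_n.+1 -> 'I_r.+1}.

Definition is_evert (n r : nat) (x : evert n r) : bool :=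
  (\sum_(j < n.+1) (x j : nat) == r)%N.

Definition ephi (n r : nat) (x : evert n r) (k : 'I_n.+1) : int :=
  (\sum_(j < n.+1 | (j <= k)%N) (x j : nat))%:Z.

Definition ecompat (n r : nat) (x y : evert n r) : bool :=
  [forall k, (ephi x k - ephi y k == 0) || (ephi x k - ephi y k == 1)] ||
  [forall k, (ephi y k - ephi x k == 0) || (ephi y k - ephi x k == 1)].

Definition is_eface (n r : nat) (F : {set evert n r}) : bool :=
  [forall x in F, is_evert x] && [forall x in F, forall y in F, ecompat x y].

(* F lies over G (a face of 2^[n+1]) iff the union of supports is in G *)
Definition esupp (n r : nat) (F : {set evert n r}) : {set 'I_n.+1} :=
  [set j | [exists x in F, (x j != 0%N :> nat)]].

Definition ef (n r : nat) (G : {set 'I_n.+1}) (i : nat) : nat :=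
  #|[set F : {set evert n r} | is_eface F && (esupp F \subset G) && (#|F| == i)]|.

Definition eh (n r : nat) (G : {set 'I_n.+1}) : {poly int} :=
  \sum_(i < #|G|.+1) ((ef r G i)%:R * ('X^i * (1 - 'X) ^+ (#|G| - i))).

Definition elocal_h (n r : nat) : {poly int} :=
  \sum_(G : {set 'I_n.+1}) ((-1) ^+ (n.+1 - #|G|) * eh r G).

(* Main.v *)
Require Import Defs.
From HB Require Import structures.
From mathcomp Require Import all_boot all_order all_algebra.
From mathcomp Require Import boolp zify ring.
Set Implicit Arguments. Unset Strict Implicit. Unset Printing Implicit Defensive.
Import Order.TTheory GRing.Theory Num.Theory.
Local Open Scope ring_scope.

(** All three polynomials equal the sum of z^((d_0 + ... + d_n) / r) over the
    sequences d in {1, ..., r-1}^(n+1) whose sum is divisible by r.  For Smirnov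
    words, d is the sequence of consecutive differences modulo r, and a descent
    is a carry of the partial sums.  For the lecture hall simplex, the barycentric
    weights of a point are recovered as d_j / r from differences of coordinates.

    For the edgewise subdivision it suffices, by inclusion-exclusion, to show
    that h of the restriction to G is the same sum over d in {0, ..., r-1}^G.
    Multiply both sides by (1 - z)^(-|G|): the left-hand side becomes the
    generating function, by total weight, of the nonnegative integer weights
    supported on faces, the right-hand side that of the points x = d + r k of N^G
    with coordinate sum divisible by r.  The map mu |-> sum_v mu(v) v is a
    bijection between the weights of total t and the points of sum r t: if psi is
    the sequence of partial sums of x, then x is the sum of the t vertices whose
    partial sums are floor((psi + a) / t), 0 <= a < t, and it has no other
    decomposition.  Power series are replaced by polynomials modulo z^(N+1). *)

(** * Reindexing of sums, and partial sums of finite sequences *)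

Lemma big_bij (R : Type) (idx : R) (op : Monoid.com_law idx) (I J : finType)
    (h : J -> I) (h' : I -> J) (P : pred I) (Q : pred J) (F : I -> R) :
    (forall i, P i -> Q (h' i)) -> (forall j, Q j -> P (h j)) ->
    (forall i, P i -> h (h' i) = i) -> (forall j, Q j -> h' (h j) = j) ->
  \big[op/idx]_(i | P i) F i = \big[op/idx]_(j | Q j) F (h j).
Proof.
move=> PQ QP hK h'K; rewrite (reindex_onto h h' hK); apply: eq_bigl => j.
apply/andP/idP => [[/PQ + /eqP e]|Qj]; first by rewrite e.
by rewrite QP ?h'K.
Qed.

Arguments big_bij {R idx op I J} h h' {P} Q {F}.

Lemma big_ord_ltS (R : Type) (idx : R) (op : Monoid.com_law idx) n (f : 'I_n -> R) (k : 'I_n) :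
  \big[op/idx]_(j < n | (j < k.+1)%N) f j = op (\big[op/idx]_(j < n | (j < k)%N) f j) (f k).
Proof.
rewrite (bigD1 k) //= Monoid.mulmC; congr (op _ _); apply: eq_bigl => j.
by rewrite ltnS [RHS]ltn_neqAle andbC.
Qed.

(** The strict bound makes index 0 the empty sum, so a sequence of length [n] has partial sums at 0,
    ..., n; [ephi v k] is the partial sum at [k.+1]. *)
Definition psum n (f : 'I_n -> nat) (k : nat) : nat :=
  (\sum_(j < n | (j < k)%N) f j)%N.

Section PartialSums.
Variable n : nat.
Implicit Types f g : 'I_n -> nat.

Lemma psum0 f : psum f 0 = 0%N.
Proof. by rewrite /psum big1. Qed.

Lemma psumS f (k : 'I_n) : psum f k.+1 = (psum f k + f k)%N.
Proof. exact: big_ord_ltS. Qed.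

Lemma psum_full f : psum f n = (\sum_j f j)%N.
Proof. by apply: eq_bigl => j; rewrite ltn_ord. Qed.

(** Recognizes a closed form for partial sums from its increments; it serves both the descent count
    and the floors of [floor_vert]. *)
Lemma psum_uniq f (F : nat -> nat) :
    F 0 = 0%N -> (forall k : 'I_n, F k.+1 = (F k + f k)%N) ->
  forall k, (k <= n)%N -> psum f k = F k.
Proof.
move=> F0 FS; elim=> [|k IH] kn; first by rewrite psum0.
by rewrite (psumS f (Ordinal kn)) IH ?(FS (Ordinal kn)) // ltnW.
Qed.

Lemma psum_inj f g : (forall k : 'I_n, psum f k.+1 = psum g k.+1) -> f =1 g.
Proof.
move=> E k; have := E k; rewrite !psumS.
suff -> : psum f k = psum g k by move/addnI.
case: k => -[|k] kn /=; first by rewrite !psum0.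
exact: (E (Ordinal (ltnW kn))).
Qed.

Lemma psum_leq f k l : (k <= l)%N -> (psum f k <= psum f l)%N.
Proof.
move=> kl; rewrite /psum !(big_mkcond (fun j : 'I_n => _ < _)%N) /=.
by apply: leq_sum => j _; case: (ltnP j k) => // jk; rewrite (leq_trans jk kl).
Qed.

Lemma psum_le_full f k : (psum f k <= \sum_j f j)%N.
Proof. by rewrite /psum [leqRHS](bigID (fun j : 'I_n => (j < k)%N)) /= leq_addr. Qed.

Lemma psum_exchange (I : finType) (c : I -> nat) (v : I -> 'I_n -> nat) k :
  psum (fun j => \sum_i c i * v i j)%N k = (\sum_i c i * psum (v i) k)%N.
Proof.
rewrite /psum exchange_big; apply: eq_bigr => i _; by rewrite big_distrr.
Qed.

End PartialSums.

(** * Smirnov words *)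

Section ConstantScale.
Variables (r n : nat) (r_gt0 : (0 < r)%N).

Definition residue (k : nat) : 'I_r := Ordinal (ltn_pmod k r_gt0).

(** The index set shared by the final sums: [d] records the differences of a word, the gaps of a
    lecture hall point, or the residues of a lattice point. *)
Definition steps (d : {ffun 'I_n.+1 -> 'I_r}) : bool :=
  [forall j, d j != 0%N :> nat] && (r %| \sum_j d j)%N.

Definition word_of_steps (d : {ffun 'I_n.+1 -> 'I_r}) : {ffun 'I_n.+2 -> 'I_r} :=
  [ffun k : 'I_n.+2 => residue (psum (fun j : 'I_n.+1 => d j : nat) k)].

(** Adding [r] before subtracting keeps the difference modulo [r] clear of truncated subtraction. *)
Definition steps_of_word (w : {ffun 'I_n.+2 -> 'I_r}) : {ffun 'I_n.+1 -> 'I_r} :=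
  [ffun j : 'I_n.+1 => residue (w (inord j.+1) + (r - w (inord j)))].

(** The differences telescope modulo [r], starting from the letter 0. *)
Lemma psum_steps_of_word (w : {ffun 'I_n.+2 -> 'I_r}) : w ord0 = 0%N :> nat ->
  forall k, (k < n.+2)%N ->
    (psum (fun j : 'I_n.+1 => steps_of_word w j : nat) k %% r)%N = w (inord k).
Proof.
move=> w0; elim=> [|k IH] kn.
  by rewrite psum0 mod0n (_ : inord 0 = ord0) ?w0 //; apply/val_inj; rewrite /= inordK.
rewrite (psumS _ (Ordinal (kn : (k < n.+1)%N))) -modnDml IH 1?ltnW //.
by rewrite ffunE /= modnDmr addnCA subnKC ?modnDr ?modn_small // ltnW.
Qed.

Lemma smirnov_sum :
  \sum_(w : {ffun 'I_n.+2 -> 'I_r} | smirnov w) 'X^(des w)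
  = \sum_(d | steps d) 'X^((\sum_j d j) %/ r) :> {poly int}.
Proof.
have wS (d : {ffun 'I_n.+1 -> 'I_r}) (i : 'I_n.+1) :
    (word_of_steps d (inord i) = psum (fun j : 'I_n.+1 => d j : nat) i %% r :> nat)%N /\
    (word_of_steps d (inord i.+1) = (psum (fun j : 'I_n.+1 => d j : nat) i + d i) %% r :> nat)%N.
  by rewrite !ffunE /= !inordK ?psumS //; have := ltn_ord i; lia.
rewrite (big_bij word_of_steps steps_of_word steps).
- apply: eq_bigr => d /andP[_ _]; congr ('X^ _).
  (* [c] marks the descents. *)
  pose c (i : 'I_n.+1) : nat := (word_of_steps d (inord i.+1) < word_of_steps d (inord i))%N.
  have -> : des (word_of_steps d) = psum c n.+1.
    rewrite psum_full /des -sum1_card big_mkcond /=.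
    by apply: eq_bigr => i _; rewrite inE /c; case: ifP.
  rewrite -psum_full.
  (* The quotient by [r] of the partial sums grows by 1 exactly where the residue drops, that is, at
     a descent. *)
  apply: (psum_uniq (F := fun k => psum (fun j : 'I_n.+1 => d j : nat) k %/ r)%N) => //.
  + by rewrite psum0 div0n.
  + move=> k; rewrite psumS /c; have [-> ->] := wS d k.
    rewrite divnD // modnD // (divn_small (ltn_ord (d k))) (modn_small (ltn_ord (d k))) addn0.
    congr (_ + _)%N; have := ltn_pmod (psum (fun j : 'I_n.+1 => d j : nat) k) r_gt0.
    have := ltn_ord (d k); case: leqP; lia.
- move=> w /and3P[/eqP w0 /eqP wm /forallP wne].
  apply/andP; split; last first.
    rewrite /dvdn -psum_full psum_steps_of_word // (_ : inord n.+1 = ord_max) ?wm //.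
    by apply/val_inj; rewrite /= inordK.
  apply/forallP => j; rewrite ffunE /=; move: (wne j); apply: contra.
  move: (w _) (w _) => a b /dvdnP[q]; have := ltn_ord a; have := ltn_ord b.
  (* The shifted difference lies strictly between 0 and [2 r], so as a multiple of [r] it equals
     [r], which makes the two letters equal. *)
  case: q => [|[|q]]; nia.
- move=> d /andP[/forallP d0 dr]; apply/and3P; split.
  + by rewrite ffunE /= psum0 mod0n.
  + by rewrite ffunE /= psum_full.
  + apply/forallP => i; have [-> ->] := wS d i.
    move: (d0 i); apply: contra; rewrite -{1}[psum _ _]addn0 eqn_modDl mod0n modn_small //.
    by rewrite eq_sym.
- move=> w /and3P[/eqP w0 _ _]; apply/ffunP => k; apply/val_inj.
  by rewrite ffunE /= psum_steps_of_word // inord_val.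
- move=> d _; apply/ffunP => j; apply/val_inj; rewrite ffunE /=.
  have [-> ->] := wS d j.
  rewrite modnDml {1}(divn_eq (psum (fun j : 'I_n.+1 => d j : nat) j) r).
  rewrite -!addnA modnMDl [(d j + _)%N]addnC addnA.
  by rewrite subnKC ?(ltnW (ltn_pmod _ r_gt0)) // modnDl modn_small.
Qed.
End ConstantScale.

(** * Lecture hall simplex *)

Section LectureHall.
Variables (r n : nat) (r_gt0 : (0 < r)%N).
Implicit Types (x : 'I_n.+1 -> int) (d : {ffun 'I_n.+1 -> 'I_r}).

(** The lifted vertices have entries 0 or [r], except for the appended 1; scaling that coordinate by
    [r] makes all of them alike. *)
Definition scaling (j : nat) : int := if (j < n)%N then 1 else r%:Z.

(* For a point [x] of the parallelepiped with weights [lam], this is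
   [r * lam (n - j)]. *)
Definition gap x (j : 'I_n.+1) : int :=
  scaling j * x j - (if j == 0%N :> nat then 0 else x (inord j.-1)).

(** After scaling and reversing the vertex order, the matrix of lifted vertices is [r] times the
    triangular matrix of ones, which consecutive differences invert. *)
Lemma lift_lhs_vert (i j : 'I_n.+1) :
  scaling j * lift_vert (lhs_vert (fun _ : 'I_n => r)) i j
  = r%:Z * (rev_ord i < j.+1)%N%:Z.
Proof.
rewrite /scaling /lift_vert ltnS /= subSS; case: insubP => [k jn kj|].
  by rewrite jn mul1r /lhs_vert kj; case: ifP; rewrite ?mulr1 ?mulr0.
have := ltn_ord j; rewrite -leqNgt => jn nj; rewrite ltnNge nj /= mulr1.
by rewrite (_ : n - i <= j)%N ?mulr1 //; lia.
Qed.

Lemma sum_gap x (j : 'I_n.+1) :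
  \sum_(i < n.+1 | (i < j.+1)%N) gap x i = scaling j * x j.
Proof.
case: j => j; elim: j => [|j IH] jn; rewrite big_ord_ltS /gap /=.
  by rewrite big1 ?subr0 ?add0r.
have -> : \sum_(i < n.+1 | (i < j.+1)%N) gap x i = x (inord j).
  rewrite (IH (ltnW jn)) /scaling [(j < n)%N]jn mul1r; congr (x _).
  by apply/val_inj; rewrite /= inordK // ltnW.
by rewrite addrC subrK.
Qed.

Lemma in_open_pp_gap x :
  in_open_pp (lhs_vert (fun _ : 'I_n => r)) x <->
  forall j, 0 < gap x j < r%:Z.
Proof.
have r0 : 0 < r%:R :> rat by rewrite ltr0n.
(* Multiplied by the nonzero [scaling j], the equation for coordinate [j] prescribes a partial sum
   of the reversed weights. *)
have eqE (lam : 'I_n.+1 -> rat) j :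
    ((x j)%:~R = \sum_(i < n.+1) lam i * (lift_vert (lhs_vert (fun _ : 'I_n => r)) i j)%:~R)
    <-> ((scaling j * x j)%:~R = r%:R * \sum_(i < n.+1 | (i < j.+1)%N) lam (rev_ord i)).
  have s0 : (scaling j)%:~R != 0 :> rat.
    by rewrite intr_eq0 /scaling; case: ifP => // _; rewrite -lt0n.
  have -> : r%:R * \sum_(i < n.+1 | (i < j.+1)%N) lam (rev_ord i) =
      (scaling j)%:~R * \sum_(i < n.+1) lam i * (lift_vert (lhs_vert (fun _ : 'I_n => r)) i j)%:~R.
    rewrite (reindex_inj rev_ord_inj) /= !big_distrr /= big_mkcond /=.
    apply: eq_bigr => i _; rewrite mulrCA -intrM lift_lhs_vert rev_ordK /=.
    by case: ifP => _; rewrite ?mulr1 ?mulr0 // mulrC.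
  by rewrite intrM; split=> [-> //|/(mulfI s0)].
split=> [[lam [lam01 /(_ _)/eqE xE]] j|gapP].
  suff gapE : (gap x j)%:~R = r%:R * lam (rev_ord j).
    have /andP[l0 l1] := lam01 (rev_ord j).
    rewrite -(ltr_int rat 0) -(ltr_int rat _ r) gapE mulr_gt0 //=.
    by rewrite -[ltRHS]mulr1 ltr_pM2l.
  rewrite /gap rmorphB /= xE big_ord_ltS mulrDr addrAC.
  rewrite [X in X + _](_ : _ = 0) ?add0r //; apply/eqP; rewrite subr_eq0; apply/eqP.
  case: j => -[|j] jn /=; first by rewrite big1 ?mulr0.
  have := xE (inord j); rewrite inordK 1?ltnW // => <-.
  by rewrite /scaling [(j < n)%N]jn mul1r.
(* Solving the triangular system forces these weights. *)
exists (fun i => (gap x (rev_ord i))%:~R / r%:R); split=> [i|j].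
  have /andP[g0 g1] := gapP (rev_ord i).
  by rewrite divr_gt0 ?ltr0z //= ltr_pdivrMr // mul1r -[r%:R]/(r%:Z%:~R) ltr_int.
apply/eqE; rewrite -sum_gap rmorph_sum /= mulr_sumr; apply: eq_bigr => i _.
by rewrite rev_ordK mulrCA divff ?mulr1 // gt_eqF.
Qed.

Notation vert := (lhs_vert (fun _ : 'I_n => r)).
Notation bound := (pp_bound vert).
Notation sumto d k := (psum (fun j : 'I_n.+1 => d j : nat) k).

(** The division by [r] in the last coordinate undoes [scaling]. *)
Definition coord_of_steps (d : {ffun 'I_n.+1 -> 'I_r}) (j : nat) : nat :=
  if (j < n)%N then sumto d j.+1 else (sumto d n.+1 %/ r)%N.

Definition point_of_steps (d : {ffun 'I_n.+1 -> 'I_r}) :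
    {ffun 'I_n.+1 -> 'I_(bound.*2.+1)} :=
  [ffun j : 'I_n.+1 => inord (bound + coord_of_steps d j)].

Definition steps_of_point (y : {ffun 'I_n.+1 -> 'I_(bound.*2.+1)}) :
    {ffun 'I_n.+1 -> 'I_r} :=
  [ffun j => residue r_gt0 (absz (gap (box_pt y) j))].

(** The last coordinate is at most [n.+1], the first summand of [pp_bound]; any other one is at most
    the sum of its column of vertex entries. *)
Lemma coord_of_steps_bound d (j : nat) : (coord_of_steps d j <= bound)%N.
Proof.
rewrite /coord_of_steps; case: ifP => jn; last first.
  apply: leq_trans (leq_addr _ _); rewrite psum_full -[leqRHS](mulnK _ r_gt0).
  apply: leq_div2r; have -> : (n.+1 * r = \sum_(i < n.+1) r)%N by rewrite sum_nat_const card_ord.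
  by apply: leq_sum => i _; rewrite ltnW.
apply: leq_trans (leq_addl _ _); rewrite /psum big_mkcond (reindex_inj rev_ord_inj) /=.
apply: leq_sum => i _; rewrite (bigD1 (Ordinal jn)) //=.
apply: leq_trans (leq_addr _ _); rewrite /lhs_vert subSS ltnS /=.
by case: ifP => // _; rewrite ltnW.
Qed.

Lemma box_point_of_steps d j : box_pt (point_of_steps d) j = coord_of_steps d j.
Proof.
rewrite /box_pt ffunE inordK; first by rewrite PoszD addrC addKr.
by rewrite ltnS -addnn leq_add2l coord_of_steps_bound.
Qed.

Lemma gap_point_of_steps d j : (r %| \sum_i d i)%N ->
  gap (box_pt (point_of_steps d)) j = d j.
Proof.
move=> rd; rewrite /gap !box_point_of_steps.
have -> : scaling j * coord_of_steps d j = (sumto d j.+1)%:Z.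
  rewrite /scaling /coord_of_steps; case: ifP => jn; first by rewrite mul1r.
  have -> : j = n :> nat by have := ltn_ord j; lia.
  by rewrite -PoszM mulnC psum_full divnK.
rewrite psumS PoszD; case: j => -[|j] jn /=; first by rewrite psum0 add0r subr0.
by rewrite inordK 1?ltnW // /coord_of_steps [(j < n)%N]jn addrC addKr.
Qed.

Lemma sumto_steps_of_point (y : {ffun 'I_n.+1 -> 'I_(bound.*2.+1)}) (j : 'I_n.+1) :
    (forall i, 0 < gap (box_pt y) i < r%:Z) ->
  (sumto (steps_of_point y) j.+1)%:Z = scaling j * box_pt y j.
Proof.
move=> gapP; rewrite -sum_gap /psum -natz natr_sum; apply: eq_bigr => i _.
rewrite ffunE /=; have := gapP i; case: (gap _ _) => // k /andP[_ kr].
by rewrite natz modn_small.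
Qed.

Lemma dns_sum :
  dns (fun _ : 'I_n => r) = \sum_(d : {ffun 'I_n.+1 -> 'I_r} | steps d) 'X^((\sum_j d j) %/ r).
Proof.
rewrite /dns /lstar -big_mkcond /= (big_bij point_of_steps steps_of_point (@steps r n)).
- by apply: eq_bigr => d _; rewrite box_point_of_steps /= /coord_of_steps ltnn psum_full.
- move=> y /asboolP/in_open_pp_gap gapP; apply/andP; split.
    apply/forallP => j; rewrite ffunE /=; have := gapP j.
    by case: (gap _ _) => // k /andP[k0 kr]; rewrite modn_small // -lt0n.
  rewrite -psum_full; have := sumto_steps_of_point ord_max gapP.
  (* A negative height is impossible, since [r] times the height is a sum of naturals. *)
  rewrite /scaling ltnn /=; case: (box_pt y _) => [k|k]; last by nia.
  by rewrite -PoszM => -[->]; apply: dvdn_mulr.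
- move=> d /andP[/forallP d0 rd]; apply/asboolP/in_open_pp_gap => j.
  have := d0 j; rewrite gap_point_of_steps //.
  by rewrite !ltz_nat ltn_ord lt0n => ->.
- move=> y /asboolP/in_open_pp_gap gapP; apply/ffunP => j; apply/val_inj.
  have cE : (coord_of_steps (steps_of_point y) j)%:Z = box_pt y j.
    rewrite /coord_of_steps; have := sumto_steps_of_point j gapP.
    rewrite /scaling; case: ifP => jn; first by rewrite mul1r.
    have jE : j = n :> nat by have := ltn_ord j; lia.
    rewrite jE; case: (box_pt y j) => [k|k]; last by nia.
    by rewrite -PoszM => -[->]; rewrite mulKn.
  rewrite ffunE /= inordK; last by rewrite ltnS -addnn leq_add2l coord_of_steps_bound.
  by move: cE; rewrite /box_pt /=; lia.
- move=> d /andP[_ rd]; apply/ffunP => j; apply/val_inj.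
  by rewrite ffunE /= gap_point_of_steps //= modn_small.
Qed.
End LectureHall.

(** Hermite's identity. Passing from [m] to [m.+1] shifts the window of summation by one, trading
    the term [m %/ t] for [m %/ t + 1]. *)
Lemma sum_divn_shift t m : (0 < t)%N -> (\sum_(a < t) (m + a) %/ t)%N = m.
Proof.
case: t => // t _; elim: m => [|m IH].
  by rewrite big1 // => a _; rewrite add0n divn_small.
have : (\sum_(a < t.+2) (m + a) %/ t.+1 = m + (m %/ t.+1).+1)%N.
  by rewrite big_ord_recr /= IH divnDr // divnn addn1.
rewrite big_ord_recl /= addn0 addnS [in RHS]addnC -addnS => /addnI E; rewrite -[RHS]E.
by apply: eq_bigr => a _; rewrite addSnnS.
Qed.

(** * Faces of the edgewise subdivision *)

Section EdgewiseFaces.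
Local Open Scope nat_scope.
Variables (r n : nat).
Implicit Types (u v : evert n r) (x : 'I_n.+1 -> nat).

Notation vsum v k := (psum (fun j : 'I_n.+1 => v j : nat) k).

(** One of the two alternatives of [ecompat], stated in the naturals; it compares any two vertices
    of a face. *)
Definition estep u v :=
  [forall k : 'I_n.+1, vsum u k.+1 <= vsum v k.+1 <= (vsum u k.+1).+1].

Lemma ecompatE u v : ecompat u v = estep v u || estep u v.
Proof.
by rewrite /ecompat; congr orb; apply: eq_forallb => k;
  rewrite /ephi -/(vsum u k.+1) -/(vsum v k.+1); apply/idP/idP; lia.
Qed.

Lemma estepP u v k : estep u v -> k <= n.+1 -> vsum u k <= vsum v k <= (vsum u k).+1.
Proof.
move=> /forallP uv; case: k => [|k] kn; first by rewrite !psum0.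
exact: (uv (Ordinal kn)).
Qed.

Lemma evert_psum_inj u v : (forall k : 'I_n.+1, vsum u k.+1 = vsum v k.+1) -> u = v.
Proof. by move=> /psum_inj E; apply/ffunP => j; apply/val_inj/E. Qed.

(* The [t] vertices that a point [x] with coordinate sum [r * t] decomposes into. *)
Definition floor_vert x t a : evert n r :=
  [ffun j : 'I_n.+1 => inord ((psum x j.+1 + a) %/ t - (psum x j + a) %/ t)].

Lemma vsum_floor_vert x t a k : \sum_j x j = r * t -> a < t -> k <= n.+1 ->
  vsum (floor_vert x t a) k = (psum x k + a) %/ t.
Proof.
move=> sx at_ kn; have t0 : 0 < t by case: t at_ {sx}.
apply: (psum_uniq (F := fun k => (psum x k + a) %/ t)) => // [|{kn}k].
  by rewrite psum0 divn_small.
have lex : psum x k + a <= psum x k.+1 + a by rewrite leq_add2r psum_leq.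
(* The cast into ['I_r.+1] is exact: the partial sum is at most [r * t] and [a < t], so the quotient
   is at most [r]. *)
rewrite ffunE inordK ?subnKC ?leq_div2r // ltnS.
apply: leq_trans (leq_subr _ _) _.
rewrite -ltnS ltn_divLR // mulSn addnC -addSn leq_add // -sx.
exact: psum_le_full.
Qed.

Section Decomposition.
Variables (mu : evert n r -> nat).
Hypothesis mu_compat : forall u v, mu u != 0 -> mu v != 0 -> ecompat u v.
Let t := \sum_v mu v.
Let x (j : 'I_n.+1) := \sum_v mu v * v j.

(* Ordering the vertices with their multiplicities along the chain, [v]
   occupies the positions from [\sum_(u below v) mu u] on. *)
Lemma floor_vert_weights v i : \sum_j x j = r * t -> i < mu v ->
  let a := \sum_(u | estep u v && (u != v)) mu u + i in
  a < t /\ floor_vert x t a = v.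
Proof.
move=> sx iv /=; set L := \sum_(u | _) _; set a := L + i.
have v0 : mu v != 0 by rewrite -lt0n (leq_ltn_trans _ iv).
have at_ : L + mu v <= t.
  rewrite /t (bigD1 v) //= addnC leq_add2l /L !(big_mkcond (fun u => _ && _)) /=.
  rewrite [leqRHS]big_mkcond /=.
  by apply: leq_sum => u _; case: (estep u v); case: (u != v).
have lt_at : a < t by apply: leq_trans at_; rewrite ltn_add2l.
split=> //; apply: evert_psum_inj => k; rewrite vsum_floor_vert //.
set q := vsum v k.+1; have xE : psum x k.+1 = \sum_u mu u * vsum u k.+1.
  exact: psum_exchange.
have LE : L = \sum_u mu u * (estep u v && (u != v)).
  by rewrite /L big_mkcond; apply: eq_bigr => u _; case: ifP; rewrite ?muln1 ?muln0.
have vE : mu v = \sum_u mu u * (u == v).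
  by rewrite (bigD1 v) //= eqxx muln1 big1 ?addn0 // => u /negPf->; rewrite muln0.
have t0 : 0 < t by apply: leq_ltn_trans lt_at.
(* Termwise: a weighted vertex strictly below [v] falls short of [q] by at most 1, and every other
   one reaches [q]. *)
have lo : q * t <= psum x k.+1 + L.
  rewrite xE LE -big_split /= mulnC big_distrl /=; apply: leq_sum => u _.
  rewrite -mulnDr; case: (eqVneq (mu u) 0) => [->//|u0]; rewrite leq_mul2l; apply/orP; right.
  have := mu_compat u0 v0; rewrite ecompatE.
  case: (eqVneq u v) => [->|_]; first by rewrite leq_addr.
  case: (boolP (estep u v)) => /= [uv _|_].
    by have := estepP uv (ltn_ord k); rewrite -/q; lia.
  by rewrite orbF => vu; have := estepP vu (ltn_ord k); rewrite -/q; lia.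
(* Termwise: [v] and the vertices below it do not exceed [q], and the others do not exceed
   [q.+1]. *)
have hi : psum x k.+1 + L + mu v <= q.+1 * t.
  rewrite xE LE vE -!big_split /= mulnC big_distrl /=; apply: leq_sum => u _.
  rewrite -!mulnDr; case: (eqVneq (mu u) 0) => [->//|u0]; rewrite leq_mul2l; apply/orP; right.
  have := mu_compat u0 v0; rewrite ecompatE.
  case: (eqVneq u v) => [->|_]; first by rewrite andbF -/q; lia.
  case: (boolP (estep u v)) => /= [uv _|_].
    by have := estepP uv (ltn_ord k); rewrite -/q; lia.
  by rewrite orbF => vu; have := estepP vu (ltn_ord k); rewrite -/q; lia.
apply/eqP; rewrite eqn_leq -ltnS ltn_divLR // leq_divRL //.
by rewrite /a addnA; apply/andP; split; lia.
Qed.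

(** Uniqueness of the decomposition: the positions occupied by each vertex give an inequality, and
    both sides sum to [t], so every inequality is an equality. *)
Lemma weights_floor_vert v : \sum_j x j = r * t ->
  mu v = #|[set a : 'I_t | floor_vert x t a == v]|.
Proof.
move=> sx; pose m w := #|[set a : 'I_t | floor_vert x t a == w]|; rewrite -/(m v).
have le_mu w : mu w <= m w.
  have pos (i : 'I_(mu w)) := floor_vert_weights sx (ltn_ord i).
  pose f (i : 'I_(mu w)) : 'I_t := Ordinal (pos i).1.
  have f_inj : injective f by move=> i j /(congr1 val)/addnI/val_inj.
  rewrite -[mu w]card_ord -(card_codom f_inj); apply: subset_leq_card.
  by apply/subsetP => _ /codomP[i ->]; rewrite inE /= (pos i).2.
have sum_m : \sum_w m w = t.
  rewrite -[RHS]card_ord -sum1_card (partition_big (fun a : 'I_t => floor_vert x t a) predT) //=.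
  by apply: eq_bigr => w _; rewrite /m -sum1_card; apply: eq_bigl => a; rewrite inE.
have [_] := leqif_sum (P := predT) (fun w _ => leqif_eq (le_mu w)).
by rewrite sum_m eqxx => /esym/forall_inP/(_ v isT)/eqP.
Qed.
End Decomposition.

Lemma is_evert_floor_vert x t a : \sum_j x j = r * t -> a < t ->
  is_evert (floor_vert x t a).
Proof.
move=> sx at_; have t0 : 0 < t by case: t at_ {sx}.
rewrite /is_evert -(psum_full (fun j : 'I_n.+1 => floor_vert x t a j : nat)).
rewrite vsum_floor_vert // psum_full sx addnC mulnC.
by rewrite divnDr ?dvdn_mulr // mulKn // divn_small.
Qed.

(** Raising the shift by less than [t] raises each floor by at most 1. *)
Lemma estep_floor_vert x t a b : \sum_j x j = r * t -> a <= b -> b < t ->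
  estep (floor_vert x t a) (floor_vert x t b).
Proof.
move=> sx ab bt; have t0 : 0 < t by case: t bt {sx}.
apply/forallP => k; rewrite !vsum_floor_vert // ?(leq_ltn_trans ab) //.
have -> : ((psum x k.+1 + a) %/ t).+1 = (psum x k.+1 + a + t) %/ t.
  by rewrite [RHS]divnDr ?dvdnn // divnn t0 addn1.
by rewrite !leq_div2r //; lia.
Qed.

Lemma floor_vert_supp x t a j : \sum_j x j = r * t -> a < t ->
  x j = 0 -> floor_vert x t a j = 0 :> nat.
Proof.
move=> sx at_ xj; rewrite ffunE psumS xj addn0 subnn inordK //.
Qed.

(** Existence of the decomposition: Hermite's identity applied to every partial sum. *)
Lemma sum_floor_vert x t j : \sum_j x j = r * t ->
  \sum_(a < t) floor_vert x t a j = x j.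
Proof.
case: t => [|t] sx.
  by apply/esym/eqP; rewrite big_ord0 -leqn0 -[0](muln0 r) -sx (bigD1 j) //= leq_addr.
have := @psum_inj _ (fun j => \sum_(a < t.+1) 1 * floor_vert x t.+1 a j) x _ j.
under eq_bigr do rewrite mul1n; apply=> k; rewrite psum_exchange.
under eq_bigr => a _ do rewrite mul1n vsum_floor_vert //.
exact: sum_divn_shift.
Qed.

End EdgewiseFaces.

(** * The bijection between weights on faces and lattice points *)

Section WeightsAndPoints.
Local Open Scope nat_scope.
Variables (r n N : nat) (r_gt0 : 0 < r) (G : {set 'I_n.+1}).
Notation vert := (evert n r).
Notation weights := {ffun vert -> 'I_N.+1}.
Notation split_points := ({ffun 'I_n.+1 -> 'I_r} * {ffun 'I_n.+1 -> 'I_N.+1})%type.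
Implicit Types (mu : weights) (p : split_points).

Definition supported m (d : {ffun 'I_n.+1 -> 'I_m}) := [forall j, (d j != 0 :> nat) ==> (j \in G)].

Definition weight mu := \sum_v mu v.
Definition weight_supp mu := [set v | mu v != 0 :> nat].
Definition face_weights mu := is_eface (weight_supp mu) && (esupp (weight_supp mu) \subset G).
Definition barycenter mu (j : 'I_n.+1) := \sum_v mu v * v j.

Definition level p := (\sum_j p.1 j) %/ r + \sum_j p.2 j.
(** A lattice point is stored as its residues and quotients modulo [r], so that its generating
    function factors. *)
Definition point p (j : 'I_n.+1) := p.1 j + p.2 j * r.
Definition good_point p := [&& supported p.1, supported p.2 & r %| \sum_j p.1 j].

Definition weights_of_point p : weights :=
  [ffun v => inord #|[set a : 'I_(level p) | floor_vert r (point p) (level p) a == v]|].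
Definition point_of_weights mu : split_points :=
  ([ffun j => residue r_gt0 (barycenter mu j)], [ffun j => inord (barycenter mu j %/ r)]).

Lemma face_weightsP mu : reflect
  [/\ forall v, mu v != 0 :> nat -> is_evert v,
     forall u v, mu u != 0 :> nat -> mu v != 0 :> nat -> ecompat u v
   & forall v j, mu v != 0 :> nat -> v j != 0 :> nat -> j \in G]
  (face_weights mu).
Proof.
apply: (iffP andP) => [[/andP[/forall_inP ev /forall_inP co] /subsetP su]|[ev co su]].
  split=> [v v0|u v u0 v0|v j v0 vj].
  - by apply: ev; rewrite inE.
  - by have := co u; rewrite inE => /(_ u0)/forall_inP/(_ v); rewrite inE; apply.
  - by apply: su; rewrite inE; apply/exists_inP; exists v; rewrite ?inE.
split; last first.
  by apply/subsetP => j; rewrite inE => /exists_inP[v]; rewrite inE; apply: su.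
apply/andP; split; apply/forall_inP => u; rewrite inE => u0; first exact: ev.
by apply/forall_inP => v; rewrite inE; apply: co.
Qed.

Lemma sum_barycenter mu : face_weights mu -> \sum_j barycenter mu j = r * weight mu.
Proof.
move=> /face_weightsP[ev _ _]; rewrite exchange_big mulnC big_distrl /=.
apply: eq_bigr => v _; rewrite -big_distrr /=; case: (eqVneq (mu v : nat) 0) => [->//|v0].
by rewrite (eqP (ev v v0)).
Qed.

Lemma sum_point p : good_point p -> \sum_j point p j = r * level p.
Proof.
move=> /and3P[_ _ rd]; rewrite big_split /= -big_distrl /= /level mulnDr.
by rewrite [r * (_ %/ _)]mulnC divnK // [r * _]mulnC.
Qed.

Lemma point_of_weightsK mu : face_weights mu -> weight mu < N.+1 ->
  point (point_of_weights mu) =1 barycenter mu.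
Proof.
move=> muF muN j; rewrite /point /point_of_weights !ffunE /= inordK.
  by rewrite addnC -divn_eq.
(* The quotient fits below [N.+1]: a single coordinate is at most the total [r * weight mu]. *)
rewrite ltn_divLR //; apply: leq_ltn_trans (_ : r * weight mu < _).
  by rewrite -sum_barycenter // (bigD1 j) //= leq_addr.
by rewrite mulnC ltn_pmul2r.
Qed.

Lemma point_of_weights_good mu : face_weights mu -> weight mu < N.+1 ->
  good_point (point_of_weights mu) && (level (point_of_weights mu) == weight mu).
Proof.
move=> muF muN; have bE := point_of_weightsK muF muN.
have gp : good_point (point_of_weights mu).
  have bG j : barycenter mu j != 0 -> j \in G.
    have /face_weightsP[_ _ su] := muF; rewrite /barycenter sum_nat_eq0 negb_forall.
    case/existsP=> v; rewrite muln_eq0 negb_or => /andP[]; exact: su.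
  have sb : \sum_j point (point_of_weights mu) j = r * weight mu.
    by rewrite -sum_barycenter //; apply: eq_bigr => j _; rewrite bE.
  apply/and3P; split.
  - apply/forallP => j; apply/implyP; rewrite ffunE /= => b0; apply: bG.
    by apply: contraNneq b0 => ->; rewrite mod0n.
  - apply/forallP => j; apply/implyP; rewrite ffunE /= => b0; apply: bG.
    by apply: contraNneq b0 => ->; rewrite div0n inordK.
  - have : r %| r * weight mu by rewrite dvdn_mulr.
    by rewrite -sb big_split /= -big_distrl /= dvdn_addl // dvdn_mull.
rewrite gp -(eqn_pmul2l r_gt0) -sum_point // -sum_barycenter //.
by apply/eqP; apply: eq_bigr => j _; rewrite bE.
Qed.

Lemma weights_of_pointE p v : level p < N.+1 -> weights_of_point p v =
  #|[set a : 'I_(level p) | floor_vert r (point p) (level p) a == v]| :> nat.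
Proof.
move=> pN; rewrite ffunE inordK //; apply: leq_ltn_trans pN.
by rewrite -[leqRHS]card_ord max_card.
Qed.

Lemma sum_weights_of_point p (f : vert -> nat) : level p < N.+1 ->
  \sum_v weights_of_point p v * f v
  = \sum_(a < level p) f (floor_vert r (point p) (level p) a).
Proof.
move=> pN; rewrite [RHS](partition_big (floor_vert r (point p) (level p) \o val) predT) //=.
apply: eq_bigr => v _; rewrite weights_of_pointE // -sum1_card big_distrl /=.
by apply: eq_big => [a|a]; rewrite inE // => /eqP->; rewrite mul1n.
Qed.

Lemma weight_weights_of_point p : level p < N.+1 -> weight (weights_of_point p) = level p.
Proof.
move=> pN; have := sum_weights_of_point (fun _ => 1) pN; rewrite sum1_card card_ord => <-.
by apply: eq_bigr => v _; rewrite muln1.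
Qed.

Lemma weights_of_point_face p : good_point p -> level p < N.+1 ->
  face_weights (weights_of_point p).
Proof.
move=> gp pN; have sp := sum_point gp.
have ex v : weights_of_point p v != 0 :> nat ->
    exists a : 'I_(level p), v = floor_vert r (point p) (level p) a.
  rewrite weights_of_pointE // cards_eq0 => /set0Pn[a]; rewrite inE => /eqP <-.
  by exists a.
apply/face_weightsP; split=> [v|u v|v j] /ex[a ->].
- exact: is_evert_floor_vert.
- move=> /ex[b ->]; rewrite ecompatE; have [ab|/ltnW ba] := leqP a b.
    by rewrite [X in _ || X]estep_floor_vert ?orbT.
  by rewrite estep_floor_vert.
- apply: contraNT => jG; rewrite floor_vert_supp //.
  have /and3P[/forallP/(_ j) s1 /forallP/(_ j) s2 _] := gp.
  move: s1 s2; rewrite (negPf jG) !implybF !negbK /point => /eqP-> /eqP->; done.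
Qed.

Lemma barycenter_weights_of_point p : good_point p -> level p < N.+1 ->
  barycenter (weights_of_point p) =1 point p.
Proof.
move=> gp pN j; rewrite /barycenter sum_weights_of_point //.
exact/sum_floor_vert/sum_point.
Qed.

(** [barycenter] and the floor decomposition are mutually inverse and match weight with level; the
    bound by [N] makes the casts into finite ordinals exact. *)
Lemma sum_face_weights (R : nmodType) (F : nat -> R) :
  (\sum_(mu : weights | face_weights mu && (weight mu < N.+1)%N) F (weight mu)
  = \sum_(p : split_points | good_point p && (level p < N.+1)%N) F (level p))%R.
Proof.
rewrite (big_bij weights_of_point point_of_weights
  (fun p => good_point p && (level p < N.+1))).
- by apply: eq_bigr => p /andP[_ pN]; rewrite weight_weights_of_point.
- by move=> mu /andP[muF muN]; have /andP[-> /eqP->] := point_of_weights_good muF muN.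
- by move=> p /andP[gp pN]; rewrite weights_of_point_face ?weight_weights_of_point.
- move=> mu /andP[muF muN]; have /andP[gp /eqP lE] := point_of_weights_good muF muN.
  have /face_weightsP[_ co _] := muF.
  apply/ffunP => v; apply/val_inj => /=; rewrite weights_of_pointE ?lE //.
  (* Uniqueness of the decomposition recovers the weights. *)
  rewrite (weights_floor_vert (mu := fun v => mu v : nat)) //; last exact: sum_barycenter.
  by rewrite (funext (point_of_weightsK muF muN)).
- move=> p /andP[gp pN]; have bE := barycenter_weights_of_point gp pN.
  case: p gp pN bE => d k gp pN bE; congr pair; apply/ffunP => j; apply/val_inj.
    by rewrite ffunE /= bE /point /= addnC modnMDl modn_small.
  by rewrite ffunE /= bE /point /= addnC divnMDl // divn_small // addn0 inordK.
Qed.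
End WeightsAndPoints.

(** * Generating functions *)

Section Truncation.
Variables (R : comNzRingType) (N : nat).
Implicit Types p q : {poly R}.

(** Congruence modulo ['X^N]. *)
Definition eq_trunc p q := forall i, (i < N)%N -> p`_i = q`_i.

Lemma eq_truncM p p' q q' :
  eq_trunc p p' -> eq_trunc q q' -> eq_trunc (p * q) (p' * q').
Proof.
move=> pp qq i iN; rewrite !coefM; apply: eq_bigr => -[j ji] _ /=.
by rewrite pp ?qq //; lia.
Qed.

Lemma eq_truncX p p' k : eq_trunc p p' -> eq_trunc (p ^+ k) (p' ^+ k).
Proof. by move=> pp; elim: k => [//|k IH]; rewrite !exprS; apply: eq_truncM. Qed.

Lemma eq_trunc_sum (I : Type) (s : seq I) (P : pred I) (F F' : I -> {poly R}) :
    (forall i, P i -> eq_trunc (F i) (F' i)) ->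
  eq_trunc (\sum_(i <- s | P i) F i) (\sum_(i <- s | P i) F' i).
Proof. by move=> FF i iN; rewrite !coef_sum; apply: eq_bigr => j Pj; apply: FF. Qed.

Lemma eq_trunc_sumXn (I : finType) (P : pred I) (e : I -> nat) :
  eq_trunc (\sum_(i | P i) 'X^(e i)) (\sum_(i | P i && (e i < N)%N) 'X^(e i)).
Proof.
move=> k kN; rewrite (bigID (fun i => e i < N)%N) /= coefD [X in _ + X](_ : _ = 0) ?addr0 //.
rewrite coef_sum big1 // => i /andP[_]; rewrite -leqNgt coefXn => Ni.
by rewrite ltn_eqF // (leq_trans kN).
Qed.

Lemma geometric_sum : (1 - 'X) * \sum_(i < N) 'X^i = 1 - 'X^N :> {poly R}.
Proof. by rewrite -[1 - 'X]opprB mulNr -subrX1 opprB. Qed.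

Lemma eq_trunc_geometric : eq_trunc ((1 - 'X) * \sum_(i < N) 'X^i) 1.
Proof. by move=> i iN; rewrite geometric_sum coefB coefXn ltn_eqF // subr0. Qed.

End Truncation.

Lemma genfun_ffun (R : comNzRingType) (I : finType) m (Q : I -> pred 'I_m) :
  \sum_(f : {ffun I -> 'I_m} | [forall i, Q i (f i)]) 'X^(\sum_i f i)
  = \prod_i \sum_(j | Q i j) 'X^j :> {poly R}.
Proof.
rewrite bigA_distr_big_dep; apply: eq_big => [f|f _]; last by rewrite prodrXr.
by apply/forallP/familyP.
Qed.

(** * The h-polynomial of a restriction of the edgewise subdivision *)

Section EdgewiseH.
Variables (r n : nat) (r_gt0 : (0 < r)%N) (G : {set 'I_n.+1}).
Notation vsum v k := (psum (fun j : 'I_n.+1 => v j : nat) k).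

(* On a face, the height [\sum_(k in G) (ephi v k)] is injective; its values
   differ by less than [#|G|] because [ephi v (max G) = r] for every [v]. *)
Lemma card_eface (F : {set evert n r}) : is_eface F -> esupp F \subset G -> (#|F| <= #|G|)%N.
Proof.
move=> /andP[/forall_inP ev /forall_inP co] /subsetP su.
have suF v j : v \in F -> v j != 0%N :> nat -> j \in G.
  by move=> vF vj; apply: su; rewrite inE; apply/exists_inP; exists v.
have [->|/set0Pn[v0 v0F]] := eqVneq F set0; first by rewrite cards0.
have /existsP[g0 g0v] : [exists g, v0 g != 0%N :> nat].
  apply: contraTT r_gt0 => /existsPn v00; rewrite -leqNgt -(eqP (ev _ v0F)) big1 // => j _.
  by apply/eqP; rewrite -[_ == _]negbK v00.
have [g gG gmax] := arg_maxnP (fun j : 'I_n.+1 => j : nat) (suF _ _ v0F g0v).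
have vg v : v \in F -> vsum v g.+1 = r.
  move=> vF; apply: etrans (eqP (ev _ vF)).
  rewrite /psum big_mkcond; apply: eq_bigr => j _.
  case: ifPn => //; rewrite ltnS -ltnNge => gj; apply/esym/eqP.
  by apply: contraTT gj => /(suF _ _ vF)/gmax; rewrite -leqNgt.
have G0 : (0 < #|G|)%N by apply/card_gt0P; exists g.
pose ht (v : evert n r) := (\sum_(k in G) vsum v k.+1)%N.
(* Between two comparable vertices the height grows by less than [#|G|], so congruent heights are
   equal, and then so are all partial sums at indices in [G]. *)
have ht_step u v : u \in F -> v \in F -> estep u v -> ht u = ht v %[mod #|G|] -> u = v.
  move=> uF vF uv huv.
  have le1 k : k \in G -> (vsum u k.+1 <= vsum v k.+1)%N.
    by move=> _; have /andP[] := estepP uv (ltn_ord k).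
  have [le_uv eq_uv] := leqif_sum (fun k kG => leqif_eq (le1 k kG)).
  have lt_vu : (ht v < ht u + #|G|)%N.
    rewrite -sum1_card -big_split /= /ht (bigD1 g) //= [ltnRHS](bigD1 g) //= !vg // -addSn addn1.
    rewrite leq_add2l; apply: leq_sum => k /andP[_ _].
    by have /andP[_] := estepP uv (ltn_ord k); rewrite addn1.
  have /eqP : ht u = ht v.
    have /eqP := huv; rewrite eq_sym eqn_mod_dvd //.
    by case/dvdnP => -[|q]; rewrite -/(ht u) -/(ht v) in le_uv *; nia.
  (* At an index outside [G] the entry vanishes, and the partial sum repeats the preceding one. *)
  rewrite eq_uv => /forall_inP E; apply: evert_psum_inj => k; move: k.+1 (ltn_ord k).
  elim=> [|{}k IH] kn; first by rewrite !psum0.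
  have [k0|k0] := boolP (Ordinal kn \in G); first exact/eqP/(E _ k0).
  have z w : w \in F -> w (Ordinal kn) = 0%N :> nat.
    by move=> wF; apply/eqP; apply: contraNT k0; apply: suF.
  by rewrite !(psumS _ (Ordinal kn)) (IH (ltnW kn)) !z.
pose f v := Ordinal (ltn_pmod (ht v) G0).
have f_inj : {in F &, injective f}.
  move=> u v uF vF /(congr1 val)/= huv.
  have := co u uF => /forall_inP/(_ v vF); rewrite ecompatE => /orP[vu|uv]; last exact: ht_step.
  by apply/esym/ht_step.
by rewrite -(card_in_imset f_inj) -[leqRHS]card_ord max_card.
Qed.

(** By [card_eface] the f-vector cut off at [#|G|] misses no face. *)
Lemma eh_faces : eh r G =
  \sum_(F : {set evert n r} | is_eface F && (esupp F \subset G)) 'X^#|F| * (1 - 'X) ^+ (#|G| - #|F|).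
Proof.
pose c (F : {set evert n r}) : 'I_#|G|.+1 := inord #|F|.
have cE F : is_eface F && (esupp F \subset G) -> c F = #|F| :> nat.
  by move=> /andP[F1 F2]; rewrite inordK // ltnS card_eface.
rewrite (partition_big c predT) //=; apply: eq_bigr => i _.
rewrite /ef mulrC mulr_natr -sumr_const; apply: eq_big => F.
  rewrite inE; case FG: (is_eface F && _) => //=.
  by rewrite -(cE F FG).
by rewrite inE => /andP[_ /eqP->].
Qed.

Section Truncated.
Variable N : nat.

(** Weights are grouped by their support, each vertex of which carries a positive weight; this is a
    truncated Hilbert series of the Stanley-Reisner ring. *)
Lemma sum_weights_faces :
  \sum_(mu : {ffun evert n r -> 'I_N.+1} | face_weights G mu) 'X^(weight mu)
  = \sum_(F : {set evert n r} | is_eface F && (esupp F \subset G))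
      (\sum_(i < N.+1 | i != 0%N :> nat) 'X^i) ^+ #|F| :> {poly int}.
Proof.
rewrite (partition_big (@weight_supp r n N) (fun F => is_eface F && (esupp F \subset G))) //=.
apply: eq_bigr => F FG.
transitivity (\prod_(v : evert n r) \sum_(i < N.+1 | (i != 0%N :> nat) == (v \in F)) 'X^i : {poly int}).
  rewrite -genfun_ffun; apply: eq_bigl => mu.
  apply/andP/forallP => [[_ /eqP<-] v|muF]; first by rewrite inE.
  suff muE : weight_supp mu = F by rewrite /face_weights muE.
  by apply/setP => v; rewrite inE (eqP (muF v)).
rewrite -prodr_const big_mkcond [RHS]big_mkcond /=; apply: eq_bigr => v _.
case: (v \in F); first by apply: eq_bigl => i; rewrite eqb_id.
rewrite (big_pred1 ord0) => [|i]; first by rewrite expr0.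
by rewrite eqbF_neg negbK.
Qed.

Lemma eh_trunc :
  eq_trunc N.+1 ((1 - 'X) ^+ #|G| *
    \sum_(mu : {ffun evert n r -> 'I_N.+1} | face_weights G mu) 'X^(weight mu)) (eh r G).
Proof.
rewrite eh_faces sum_weights_faces mulr_sumr; apply: eq_trunc_sum => F /andP[F1 F2].
(* Each vertex of [F] absorbs one factor [1 - 'X], and [(1 - 'X)('X + ... + 'X^N)] is ['X] modulo
   ['X^(N+1)]. *)
rewrite -{1}(subnK (card_eface F1 F2)) exprD -mulrA mulrC -exprMn.
apply: eq_truncM => //; apply: eq_truncX => i iN.
have := geometric_sum int N.+1; rewrite (bigD1 ord0) //= mulrDr expr0 mulr1 => E.
rewrite (_ : _ * _ = 'X - 'X^(N.+1)) ?coefB ?coefXn ?ltn_eqF ?subr0 //.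
by apply: (addrI (1 - 'X)); rewrite E; ring.
Qed.

(** The sum factors into residues and quotients; the quotients give one truncated geometric series
    per element of [G], cancelled by the powers of [1 - 'X]. *)
Lemma steps_trunc :
  eq_trunc N.+1 ((1 - 'X) ^+ #|G| *
    \sum_(p : {ffun 'I_n.+1 -> 'I_r} * {ffun 'I_n.+1 -> 'I_N.+1} | good_point G p) 'X^(level p))
   (\sum_(d : {ffun 'I_n.+1 -> 'I_r} | supported G d && (r %| \sum_j d j)%N)
      'X^((\sum_j d j) %/ r) : {poly int}).
Proof.
have -> : \sum_(p : {ffun 'I_n.+1 -> 'I_r} * {ffun 'I_n.+1 -> 'I_N.+1} | good_point G p) 'X^(level p)
   = (\sum_(d : {ffun 'I_n.+1 -> 'I_r} | supported G d && (r %| \sum_j d j)%N)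
      'X^((\sum_j d j) %/ r)) *
     \sum_(k : {ffun 'I_n.+1 -> 'I_N.+1} | supported G k) 'X^(\sum_j k j) :> {poly int}.
  rewrite big_distrlr /= pair_big; apply: eq_big => [[d k]|[d k] _] /=.
    by rewrite /good_point /= -andbA [X in _ && X]andbC.
  by rewrite -exprD.
rewrite mulrCA -[X in eq_trunc _ _ X]mulr1; apply: eq_truncM => //.
have -> : \sum_(k : {ffun 'I_n.+1 -> 'I_N.+1} | supported G k) 'X^(\sum_j k j)
    = (\sum_(j < N.+1) 'X^j) ^+ #|G| :> {poly int}.
  transitivity (\prod_(i < n.+1) \sum_(j < N.+1 | (j != 0%N :> nat) ==> (i \in G)) 'X^j : {poly int}).
    by rewrite -genfun_ffun.
  rewrite -prodr_const [RHS]big_mkcond; apply: eq_bigr => i _.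
  case: (i \in G); first by apply: eq_bigl => j; rewrite implybT.
  rewrite (big_pred1 ord0) => [|j]; first by rewrite expr0.
  by rewrite implybF negbK.
by have := eq_truncX #|G| (@eq_trunc_geometric int N.+1); rewrite expr1n exprMn.
Qed.
End Truncated.

Lemma eh_steps : eh r G =
  \sum_(d : {ffun 'I_n.+1 -> 'I_r} | supported G d && (r %| \sum_j d j)%N) 'X^((\sum_j d j) %/ r).
Proof.
(* For the coefficient of degree [c], the truncation [N = c] suffices. *)
apply/polyP => c; rewrite -(steps_trunc (ltnSn c)) -(eh_trunc (ltnSn c)).
apply: eq_truncM (ltnSn c) => // i iN.
by rewrite (eq_trunc_sumXn _ _ _ iN) [RHS](eq_trunc_sumXn _ _ _ iN)
  (sum_face_weights c r_gt0 G (fun k => 'X^k : {poly int})).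
Qed.
End EdgewiseH.

(** * Inclusion-exclusion and the local h-polynomial *)

(** Both sides equal the product over [j] of [1 - [d j = 0]]: in its expansion, [G] collects the
    factors that contribute 1, and the term survives when [d] vanishes off [G]. *)
Lemma sum_sign_supported n m (d : {ffun 'I_n.+1 -> 'I_m}) :
  \sum_(G : {set 'I_n.+1} | supported G d) (-1) ^+ (n.+1 - #|G|)
  = ([forall j, d j != 0%N :> nat])%:R :> {poly int}.
Proof.
transitivity (\prod_j (1 + - (d j == 0%N :> nat)%:R) : {poly int}).
  rewrite bigA_distr big_mkcond /=; apply: eq_bigr => G _; case: ifPn => [/forallP dG|].
    have -> : (n.+1 - #|G| = #|~: G|)%N by have := cardsC G; rewrite card_ord; lia.
    rewrite -prodr_const big_mkcond; apply: eq_bigr => j _; rewrite inE.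
    by have := dG j; case: (j \in G) => //=; rewrite implybF negbK => ->.
  rewrite negb_forall => /existsP[j]; rewrite negb_imply => /andP[dj jG].
  by rewrite (bigD1 j) //= (negPf jG) (negPf dj) oppr0 mul0r.
have [/forallP d0|] := boolP [forall j, d j != 0%N :> nat].
  by rewrite big1 // => j _; rewrite (negPf (d0 j)) oppr0 addr0.
rewrite negb_forall => /existsP[j]; rewrite negbK => dj.
by rewrite (bigD1 j) //= dj subrr mul0r.
Qed.

Lemma elocal_h_sum r n : (0 < r)%N ->
  elocal_h n r = \sum_(d : {ffun 'I_n.+1 -> 'I_r} | steps d) 'X^((\sum_j d j) %/ r).
Proof.
move=> r_gt0; rewrite /elocal_h.
under eq_bigr => G _ do rewrite eh_steps // mulr_sumr.
(* With the sum over [G] innermost, the signs leave only the sequences with no zero entry. *)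
rewrite (exchange_big_dep (fun d : {ffun 'I_n.+1 -> 'I_r} => r %| \sum_j d j)%N) /=; last first.
  by move=> G d _ /andP[].
rewrite [RHS](eq_bigl (fun d : {ffun 'I_n.+1 -> 'I_r} =>
  (r %| \sum_j d j)%N && [forall j, d j != 0%N :> nat])) ?big_mkcondr /=; last first.
  by move=> d; rewrite /steps andbC.
apply: eq_bigr => d rd; rewrite -mulr_suml.
rewrite (eq_bigl (fun G : {set 'I_n.+1} => supported G d)) => [|G]; last by rewrite rd andbT.
by rewrite sum_sign_supported; case: [forall _, _]; rewrite ?mul1r ?mul0r.
Qed.

Theorem theorem4p4 (r n : nat) (hr : (0 < r)%N) :
  dns (fun _ : 'I_n => r) =
    \sum_(w : {ffun 'I_n.+2 -> 'I_r} | smirnov w) 'X^(des w)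
  /\ elocal_h n r = dns (fun _ : 'I_n => r).
Proof. by rewrite dns_sum // elocal_h_sum // smirnov_sum. Qed.
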